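(* Let $R$ be a valuation domain of cardinality $\aleph_1$ and $J/R$ an essentially countable type with $J$ not countably generated. Then there is an explicitly non-standard uniserial $R$-module of type $J/R$.
   Context: A valuation domain is an integral domain whose ideals are linearly ordered; $Q$ is its quotient field. A module is uniserial if its submodules are linearly ordered. A uniserial $R$-module is standard if isomorphic to $J'/A$ for $R$-submodules $A\subseteq J'$ of $Q$, non-standard otherwise. For a uniserial $U$ and $0\neq a\in U$, $\mathrm{Ann}(a)=\{r\in R:ra=0\}$, $D(a)=\bigcup\{r^{-1}R: a\in rU\}$; $U$ has type $J/A$ if $J/A\cong D(a)/\mathrm{Ann}(a)$. A type $J/R$: $R\subseteq J\subseteq Q$, $J$ an $R$-submodule, written $J=\bigcup_{\sigma<\omega_1} r_\sigma^{-1}R$ with nonzero $r_\sigma\in R$, $r_\tau\mid r_\sigma$ and $r_\sigma\nmid r_\tau$ for $\tau<\sigma$. The type is essentially countable if there is $\gamma<\omega_1$ with $r_\gamma R/r_\sigma R$ countable for all $\gamma<\sigma<\omega_1$ (independent of the choice of the $r_\sigma$). For $U$ of type $J/R$, fix $a_\sigma\in U$ with $\mathrm{Ann}(a_\sigma)=r_\sigma R$ and let $I_\sigma$ be the set of $R$-module isomorphisms $a_\sigma R\to r_\sigma^{-1}R/R$. A special family of functions for $U$ is a family of maps $f_\sigma:I_\sigma\to\mathbb{Q}$ ($\sigma<\omega_1$) such that $f_\sigma(\psi)<f_\rho(\varphi)$ whenever $\sigma<\rho$, $\psi\in I_\sigma$, $\varphi\in I_\rho$ and $\varphi$ extends $\psi$.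 $U$ is explicitly non-standard if it has a special family of functions. *)

(* Defs.v *)
From HB Require Import structures.
From mathcomp Require Import all_boot all_order all_algebra.
From mathcomp Require Import fraction.
Set Implicit Arguments. Unset Strict Implicit. Unset Printing Implicit Defensive.
Import Order.TTheory GRing.Theory Num.Theory.
Local Open Scope ring_scope.

Notation "x %:F" := (@FracField.tofrac _ x) : ring_scope.

Definition countable_set (T : Type) (P : T -> Prop) : Prop :=
  exists g : nat -> option T, forall x, P x -> exists n, g n = Some x.

Definition omega1_order (W : Type) (lt : W -> W -> Prop) : Prop :=
  (forall x, ~ lt x x) /\
  (forall x y z, lt x y -> lt y z -> lt x z) /\
  (forall x y, lt x y \/ x = y \/ lt y x) /\
  well_founded lt /\
  (forall w, countable_set (fun x => lt x w)) /\
  ~ countable_set (fun _ : W => True).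

Definition card_aleph1 (T : Type) : Prop :=
  exists (W : Type) (lt : W -> W -> Prop) (f : W -> T),
    omega1_order lt /\ bijective f.

Definition dvd (R : idomainType) (a b : R) : Prop := exists t, b = a * t.

Definition is_ideal (R : idomainType) (I : R -> Prop) : Prop :=
  [/\ I 0, (forall x y, I x -> I y -> I (x + y)) &
      (forall r x, I x -> I (r * x))].

Definition valuation_domain (R : idomainType) : Prop :=
  forall I J : R -> Prop, is_ideal I -> is_ideal J ->
    (forall x, I x -> J x) \/ (forall x, J x -> I x).

Definition inR (R : idomainType) (x : {fraction R}) : Prop :=
  exists t : R, x = t%:F.

Definition in_invR (R : idomainType) (r : R) (x : {fraction R}) : Prop :=
  inR (x * r%:F).

(* Isomorphism of R-modules B1/A1 ~= B2/A2 for R-submodules A_i <= B_i of Q,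
   presented by a map phi : Q -> Q which is R-linear modulo A2 on B1, maps
   B1 into B2, has kernel (mod A2) exactly A1, and is onto B2 modulo A2. *)
Definition quot_iso (R : idomainType) (A1 B1 A2 B2 : {fraction R} -> Prop) : Prop :=
  exists phi : {fraction R} -> {fraction R},
    [/\ (forall x, B1 x -> B2 (phi x)),
        (forall x y (s t : R), B1 x -> B1 y ->
            A2 (phi (s%:F * x + t%:F * y) - (s%:F * phi x + t%:F * phi y))),
        (forall x, B1 x -> (A2 (phi x) <-> A1 x)) &
        (forall y, B2 y -> exists2 x, B1 x & A2 (phi x - y))].

Definition is_submodule (R : idomainType) (U : lmodType R) (P : U -> Prop) : Prop :=
  [/\ P 0, (forall x y, P x -> P y -> P (x + y)) &
      (forall (r : R) x, P x -> P (r *: x))].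

Definition uniserial (R : idomainType) (U : lmodType R) : Prop :=
  forall A B : U -> Prop, is_submodule A -> is_submodule B ->
    (forall x, A x -> B x) \/ (forall x, B x -> A x).

Definition ann_eq (R : idomainType) (U : lmodType R) (a : U) (r : R) : Prop :=
  forall s : R, s *: a = 0 <-> dvd r s.

Definition AnnQ (R : idomainType) (U : lmodType R) (a : U) (x : {fraction R}) : Prop :=
  exists2 s : R, s *: a = 0 & x = s%:F.

Definition DQ (R : idomainType) (U : lmodType R) (a : U) (x : {fraction R}) : Prop :=
  exists r : R, [/\ r != 0, (exists u : U, a = r *: u) & in_invR r x].

Definition has_type (R : idomainType) (U : lmodType R) (J : {fraction R} -> Prop) : Prop :=
  exists a : U, a != 0 /\ quot_iso (@inR R) J (AnnQ a) (DQ a).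

Definition type_presentation (R : idomainType) (J : {fraction R} -> Prop)
    (W : Type) (lt : W -> W -> Prop) (r : W -> R) : Prop :=
  [/\ (forall x, inR x -> J x),
      J 0 /\ (forall x y (s t : R), J x -> J y -> J (s%:F * x + t%:F * y)),
      (forall s, r s != 0),
      (forall t s, lt t s -> dvd (r t) (r s) /\ ~ dvd (r s) (r t)) &
      (forall x, J x <-> exists s, in_invR (r s) x)].

(* essentially countable: there is g with r_g R / r_s R countable for g < s *)
Definition ess_countable (R : idomainType) (W : Type) (lt : W -> W -> Prop)
    (r : W -> R) : Prop :=
  exists g : W, forall s, lt g s ->
    exists h : nat -> R, forall x, dvd (r g) x ->
      exists n, dvd (r s) (x - h n).

Definition countably_generated (R : idomainType) (J : {fraction R} -> Prop) : Prop :=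
  exists g : nat -> {fraction R}, (forall n, J (g n)) /\
    forall x, J x -> exists (n : nat) (c : nat -> R),
      x = \sum_(i < n) (c i)%:F * g i.

Definition in_cyc (R : idomainType) (U : lmodType R) (a x : U) : Prop :=
  exists t : R, x = t *: a.

(* psi : U -> Q represents an R-isomorphism  aR -> r^{-1}R/R  (values taken
   modulo R; only the restriction to aR matters). *)
Definition iso_rep (R : idomainType) (U : lmodType R) (a : U) (r : R)
    (psi : U -> {fraction R}) : Prop :=
  [/\ (forall x, in_cyc a x -> in_invR r (psi x)),
      (forall x y (s t : R), in_cyc a x -> in_cyc a y ->
          inR (psi (s *: x + t *: y) - (s%:F * psi x + t%:F * psi y))),
      (forall x, in_cyc a x -> (inR (psi x) <-> x = 0)) &
      (forall y, in_invR r y -> exists2 x, in_cyc a x & inR (psi x - y))].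

Definition extends_on (R : idomainType) (U : lmodType R) (a : U)
    (phi psi : U -> {fraction R}) : Prop :=
  forall x, in_cyc a x -> inR (phi x - psi x).

(* a special family of functions f_s : I_s -> rat (f s is required to be
   well defined on isomorphisms, i.e. independent of the representative) *)
Definition special_family (R : idomainType) (U : lmodType R) (W : Type)
    (lt : W -> W -> Prop) (r : W -> R) (a : W -> U)
    (f : W -> (U -> {fraction R}) -> rat) : Prop :=
  (forall s psi psi', iso_rep (a s) (r s) psi -> iso_rep (a s) (r s) psi' ->
     extends_on (a s) psi psi' -> f s psi = f s psi') /\
  (forall s p psi phi, lt s p -> iso_rep (a s) (r s) psi ->
     iso_rep (a p) (r p) phi -> extends_on (a s) phi psi ->
     f s psi < f p phi).

Definition explicitly_nonstandard (R : idomainType) (U : lmodType R) (W : Type)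
    (lt : W -> W -> Prop) (r : W -> R) : Prop :=
  (exists a : W -> U, forall s, ann_eq (a s) (r s)) /\
  (forall a : W -> U, (forall s, ann_eq (a s) (r s)) ->
     exists f, special_family lt r a f).

(* Main.v *)
(** A module of type [J/R] is a direct limit of the cyclic modules [R/r_s R] along
    multiplications by units [c_ts], where [c_ut c_ts = c_us] modulo [r_s]. An
    isomorphism [a_s R -> r_s^-1 R/R] is then a unit modulo [r_s], and it is extended by
    the unit [x] modulo [r_t] iff it equals [c_ts x]. Choosing [g] as in the definition
    of essential countability and all [c_ts] in [1 + r_g R], the tree of these
    isomorphisms splits into translates of one tree whose levels, quotients of
    [1 + r_g R], are countable.

    The [c_ts] and a strictly increasing map of that tree to the rationals are built
    together, as for a special Aronszajn tree. All nodes of a new level [d] are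
    translates of a single branch of the tree below it, so this branch has to be
    generic: it is built along a sequence cofinal in [d], keeping the rational values
    bounded along every translate, and nearly constant along suitable ones.
    This needs infinite fibres between distinct levels, so it is done on the indices [s]
    such that [[t, s[] is infinite whenever [g <= t < s]. An arbitrary isomorphism is
    coloured by its value at the last such index below its own, together with a number
    telling apart the countably many indices that have the same last index below them.
    These countably many colours are injective on chains; summing weights [2^-k] over
    the colours [k] seen so far, up to the current one, turns any such colouring into a
    strictly increasing map to the rationals. *)
From HB Require Import structures.
From mathcomp Require Import all_boot all_order all_algebra.
From mathcomp Require Import fraction ring_quotient ring lra.
From mathcomp Require Import boolp classical_sets functions cardinality.
From Stdlib Require Inverse_Image.
Set Implicit Arguments. Unset Strict Implicit. Unset Printing Implicit Defensive.
Import Order.TTheory GRing.Theory Num.Theory.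
Require Import Defs.
Local Open Scope classical_set_scope.
Local Open Scope quotient_scope.
Local Open Scope ring_scope.

Lemma well_founded_construction (L T : Type) (lt : L -> L -> Prop) (x0 : T)
    (P : L -> (L -> T) -> T -> Prop) :
  well_founded lt ->
  (forall d D D' x, (forall t, lt t d -> D t = D' t) -> P d D x -> P d D' x) ->
  (forall d D, (forall t, lt t d -> P t D (D t)) -> exists x, P d D x) ->
  exists D, forall d, P d D (D d).
Proof.
move=> lt_wf P_local P_ex.
have /choice[next nextP] : forall q : L * (L -> T), exists x,
    (exists x', P q.1 q.2 x') -> P q.1 q.2 x.
  by move=> q; have [[x ?]|] := pselect (exists x', P q.1 q.2 x'); [exists x|exists x0].
pose extend d (D : forall t, lt t d -> T) t :=
  if pselect (lt t d) is left td then D t td else x0.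
pose D := Fix lt_wf (fun=> T) (fun d D => next (d, extend d D)).
have D_below d t : lt t d -> extend d (fun t _ => D t) t = D t.
  by move=> td; rewrite /extend; case: pselect.
have DE d : D d = next (d, extend d (fun t _ => D t)).
  rewrite /D Fix_eq // => x g g' gg'; congr (next (_, _)).
  by apply/funext => t; rewrite /extend; case: pselect.
exists D; elim/(well_founded_ind lt_wf) => d IH.
rewrite DE; apply: (P_local d _ _ _ (@D_below d)).
apply: (nextP (d, _)) => /=; have [x xP] := P_ex d D IH.
by exists x; apply: P_local xP => t td; rewrite D_below.
Qed.

(** * Maps to the rationals *)

Definition dyadic (n : nat) : rat := 2^-1 ^+ n.

Lemma dyadic_gt0 n : 0 < dyadic n.
Proof. by rewrite exprn_gt0 // invr_gt0. Qed.

Lemma dyadicS n : dyadic n.+1 = dyadic n / 2.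
Proof. by rewrite /dyadic exprSr. Qed.

Lemma dyadic_le m n : (m <= n)%N -> dyadic n <= dyadic m.
Proof. by move=> mn; rewrite /dyadic ler_wiXn2l. Qed.

Lemma dyadic_small (e : rat) : 0 < e -> exists n, dyadic n < e.
Proof.
move=> e_gt0; exists (Num.bound e^-1).
by rewrite /dyadic exprVn invf_plt ?posrE ?exprn_gt0 ?upper_nthrootP.
Qed.

Lemma sum_dyadic_lt m n : \sum_(m.+1 <= k < n) dyadic k < dyadic m.
Proof.
have [nm|mn] := leqP n m.+1; first by rewrite big_geq ?dyadic_gt0.
rewrite (@telescope_sumr_eq _ _ _ (fun k => - (2 * dyadic k))) ?(ltnW mn) //.
  by have := dyadic_gt0 n; rewrite dyadicS; lra.
by move=> k _; rewrite dyadicS; lra.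
Qed.

Lemma sum_dyadic_subset_lt (P Q : pred nat) (m n : nat) :
  {subset P <= Q} -> Q n -> ~~ P n ->
  \sum_(0 <= k < m | P k) dyadic k < \sum_(0 <= k < n.+1 | Q k) dyadic k.
Proof.
move=> PQ Qn Pn.
have sumP_ge0 a b : 0 <= \sum_(a <= k < b | P k) dyadic k.
  by apply: sumr_ge0 => k _; rewrite ltW ?dyadic_gt0.
have -> : \sum_(0 <= k < n.+1 | Q k) dyadic k =
    \sum_(0 <= k < n | Q k) dyadic k + dyadic n.
  by rewrite big_mkcond big_nat_recr //= Qn -big_mkcond.
have PQn : \sum_(0 <= k < n | P k) dyadic k <= \sum_(0 <= k < n | Q k) dyadic k.
  rewrite big_mkcond [leRHS]big_mkcond; apply: ler_sum => k _.
  have := dyadic_gt0 k; case: ifP => [/PQ|_]; last by case: ifP => _; lra.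
  by rewrite -topredE /= => ->.
apply: (@le_lt_trans _ _ (\sum_(0 <= k < maxn m n.+1 | P k) dyadic k)).
  by rewrite [leRHS](big_cat_nat (leq0n m) (leq_maxl _ _)) lerDl.
rewrite (big_cat_nat (leq0n n.+1) (leq_maxr _ _)) /=.
have -> : \sum_(0 <= k < n.+1 | P k) dyadic k = \sum_(0 <= k < n | P k) dyadic k.
  by rewrite big_mkcond big_nat_recr //= (negPf Pn) addr0 -big_mkcond.
apply: ler_ltD PQn _; apply: le_lt_trans (sum_dyadic_lt n (maxn m n.+1)).
rewrite big_mkcond; apply: ler_sum => k _.
by have := dyadic_gt0 k; case: ifP => _; lra.
Qed.

Lemma specialization_of_colouring (T : Type) (le : T -> T -> Prop) (col : T -> nat) :
  (forall x y z, le x y -> le y z -> le x z) ->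
  (forall x y, le x y -> le y x -> col x = col y) ->
  exists h : T -> rat, (forall x y, le x y -> le y x -> h x = h y) /\
    forall x y, le x y -> le y y -> (forall z, le z x -> col z <> col y) -> h x < h y.
Proof.
move=> le_trans col_eq; pose seen x k := `[< exists z, le z x /\ col z = k >].
exists (fun x => \sum_(0 <= k < (col x).+1 | seen x k) dyadic k).
have seen_sub x y : le x y -> {subset seen x <= seen y}.
  move=> xy k /asboolP[z [zx zk]]; apply/asboolP; exists z; split=> //.
  exact: le_trans xy.
split=> [x y xy yx|x y xy yy new].
  rewrite (col_eq _ _ xy yx); apply: eq_bigl => k; apply/idP/idP; exact: seen_sub.
apply: sum_dyadic_subset_lt; first exact: seen_sub.
- by apply/asboolP; exists y.
- by apply/asboolPn => -[z [zx]]; apply: new.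
Qed.

Lemma strict_upper_bound_near (F : archiRealFieldType) (a : nat -> F) (b e : F) :
  0 < e -> (forall n, a n <= b) ->
  exists q, (forall n, a n < q) /\ (exists n, q <= a n + e).
Proof.
move=> e_gt0 ab; pose u k := a 0%N + e *+ k.
have u_bounds : exists k, `[< forall n, a n < u k >].
  have ba : 0 <= (b - a 0%N) / e by rewrite divr_ge0 ?subr_ge0 // ltW.
  exists (Num.bound ((b - a 0%N) / e)); apply/asboolP => n; apply: le_lt_trans (ab n) _.
  by rewrite -ltrBlDl -mulr_natl -ltr_pdivrMr // archi_boundP.
have [k /asboolP uk kmin] := ex_minnP u_bounds; exists (u k); split=> //.
case: k uk kmin => [/(_ 0%N)|k _ kmin]; first by rewrite /u addr0 ltxx.
have : ~ (forall n, a n < u k) by move/asboolP/kmin; rewrite ltnn.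
move=> /existsNP[n /negP]; rewrite -leNgt => le_n; exists n.
by rewrite /u mulrSr addrA lerD2r.
Qed.

(** * Coherent translations of a tree with a strictly increasing map *)

Lemma cofinal_sequence (disp : Order.disp_t) (L : orderType disp) (d s0 : L) :
  countable_set (fun x => x < d)%O -> (s0 < d)%O ->
  exists sg : nat -> L, [/\ forall n, (sg n < d)%O,
    {homo sg : m n / (m <= n)%N >-> (m <= n)%O} &
    forall s, (s < d)%O -> exists n, (s <= sg n)%O].
Proof.
move=> [e eP] s0d.
pose x n := if e n is Some y then if (y < d)%O then y else s0 else s0.
have x_lt n : (x n < d)%O by rewrite /x; case: (e n) => // y; case: ifP.
pose fix sg n := if n is m.+1 then Order.max (sg m) (x m) else s0.
exists sg; split.
- by elim=> // n IH; rewrite /= gt_max IH x_lt.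
- apply: homo_leq => [//|? ? ?|n /=]; first exact: le_trans.
  by rewrite le_max lexx.
- move=> s sd; have [n en] := eP _ sd; exists n.+1.
  by rewrite /= le_max /x en sd lexx orbT.
Qed.

Section CoherentSpecialization.
Context (disp : Order.disp_t) (L : orderType disp) (G : zmodType).
Variable K : L -> G -> Prop.
Hypothesis K0 : forall s, K s 0.
Hypothesis KB : forall s x y, K s x -> K s y -> K s (x - y).
Hypothesis K_le : forall s t x, (s <= t)%O -> K t x -> K s x.

Definition cong (s : L) (x y : G) : Prop := K s (x - y).
Local Notation "x =[ s ] y" := (cong s x y) (at level 70, s at level 60).

Lemma cong_refl s x : x =[s] x.
Proof. by rewrite /cong subrr; apply: K0. Qed.
#[local] Hint Resolve cong_refl : core.

Lemma cong_sym s x y : x =[s] y -> y =[s] x.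
Proof. by move=> xy; rewrite /cong -opprB -sub0r; apply: KB (K0 s) xy. Qed.

Lemma cong_trans s y x z : x =[s] y -> y =[s] z -> x =[s] z.
Proof.
by move=> xy /cong_sym zy; have := KB xy zy; rewrite opprB addrA subrK.
Qed.

Lemma congD s x x' y y' : x =[s] x' -> y =[s] y' -> x + y =[s] x' + y'.
Proof.
move=> xx' /cong_sym yy'; have := KB xx' yy'.
by rewrite /cong opprB opprD addrACA.
Qed.

Lemma congDl s z x y : x =[s] y -> z + x =[s] z + y.
Proof. exact: congD. Qed.

Lemma congDr s z x y : x =[s] y -> x + z =[s] y + z.
Proof. by move=> /congD; apply. Qed.

Lemma cong_subr s x y z : (x =[s] y - z) = (x + z =[s] y).
Proof. by rewrite /cong opprB addrA. Qed.

Lemma cong_le s t x y : (s <= t)%O -> x =[t] y -> x =[s] y.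
Proof. exact: K_le. Qed.

Hypothesis L_wf : well_founded (fun s t : L => s < t)%O.
Hypothesis L_countable : forall d : L, countable_set (fun s => s < d)%O.
Hypothesis K_countable : forall s, exists v : nat -> G, forall x, exists n, x =[s] v n.
Hypothesis K_infinite : forall s t (B : seq G), (s < t)%O ->
  exists x, x =[s] 0 /\ forall b, b \in B -> ~ x =[t] b.

(* The points of level [d] are [G] modulo [K d], and [x] lies above [x + cd s] at
   level [s]. The last clause (points lift to level [d] simultaneously for finitely
   many translates, at an arbitrarily small cost) keeps the recursion going. *)
Definition stage d (c : L -> L -> G) (f : L -> G -> rat) (cd : L -> G)
    (fd : G -> rat) : Prop :=
  [/\ cd d = 0,
      forall s t, (s <= t)%O -> (t < d)%O -> cd t + c t s =[s] cd s,
      forall x y, x =[d] y -> fd x = fd y,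
      forall s x, (s < d)%O -> f s (x + cd s) < fd x
    & forall s x (F : seq G) e, (s < d)%O -> 0 < e ->
        exists y, y + cd s =[s] x /\
          forall a, a \in F -> fd (a + y) <= f s (a + x) + e].

Section StageStep.
Variables (d : L) (c : L -> L -> G) (f : L -> G -> rat).
Hypothesis stages : forall t, (t < d)%O -> stage t c f (c t) (f t).

Lemma transition_refl t : (t < d)%O -> c t t = 0.
Proof. by case/stages. Qed.

Lemma transition_coherent s t u : (s <= t)%O -> (t <= u)%O -> (u < d)%O ->
  c u t + c t s =[s] c u s.
Proof.
move=> st; rewrite le_eqVlt => /predU1P[<- td|tu /stages[_ + _ _ _]]; last exact.
by rewrite transition_refl // add0r.
Qed.

Lemma stage_cong s x y : (s < d)%O -> x =[s] y -> f s x = f s y.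
Proof. by case/stages => _ _ + _ _; apply. Qed.

Lemma stage_transition_le s t x : (s <= t)%O -> (t < d)%O -> f s (x + c t s) <= f t x.
Proof.
rewrite le_eqVlt => /predU1P[<- td|st /stages[_ _ _ f_mono _]].
  by rewrite transition_refl // addr0.
exact/ltW/f_mono.
Qed.

Lemma stage_lift s t x (F : seq G) e : (s <= t)%O -> (t < d)%O -> 0 < e ->
  exists y, y + c t s =[s] x /\ forall a, a \in F -> f t (a + y) <= f s (a + x) + e.
Proof.
rewrite le_eqVlt => /predU1P[<- sd e_gt0|st td].
  by exists x; rewrite transition_refl // addr0; split=> // a _; rewrite lerDl ltW.
by case: (stages td) => _ _ _ _; apply.
Qed.

Variables (sg : nat -> L) (v : nat -> G).
Hypothesis sg_lt : forall n, (sg n < d)%O.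
Hypothesis sg_homo : {homo sg : m n / (m <= n)%N >-> (m <= n)%O}.
Hypothesis sg_cofinal : forall s, (s < d)%O -> exists n, (s <= sg n)%O.
Hypothesis v_dense : forall x, exists n, x =[d] v n.

(* [w] translates the branch through [y] at level [sg n] so that it passes through
   [v i] at level [sg k], while avoiding the first [n] classes modulo [K d]. *)
Definition redirects n y k i w : Prop :=
  [/\ w + y + c (sg n) (sg k) =[sg k] v i,
      forall l, (l <= n)%N -> f (sg n) (v l + w + y) <= f (sg k) (v l + v i) + dyadic n
    & forall l j, (l <= n)%N -> (j <= n)%N -> ~ v l + w =[d] v j].

Lemma redirects_exists n y k i : (k <= n)%N -> exists w, redirects n y k i w.
Proof.
move=> kn; pose I := iota 0 n.+1.
have inI l : (l <= n)%N -> l \in I by move=> ln; rewrite mem_iota.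
have [z [zK zf]] := stage_lift (v i) (map v I) (sg_homo kn) (sg_lt n) (dyadic_gt0 n).
have [u [u0 uB]] := K_infinite [seq v j - v l - (z - y) | j <- I, l <- I] (sg_lt n).
have uzE : u + (z - y) + y = u + z by rewrite -addrA subrK.
exists (u + (z - y)); split=> [|l ln|l j ln jn].
- rewrite uzE -addrA -[v i]add0r; apply: congD zK.
  exact: cong_le (sg_homo kn) u0.
- rewrite -addrA uzE (@stage_cong (sg n) _ (v l + z)) //; first exact/zf/map_f/inI.
  by apply: congDl; rewrite -[z in X in cong _ _ X]add0r; apply: congDr.
- rewrite addrC -!cong_subr; apply: uB.
  by apply: (allpairs_f (fun j l => v j - v l - (z - y))); apply: inI.
Qed.

Definition protects n y (A : seq G) : Prop :=
  (forall l, (l <= n)%N -> v l \in A) /\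
  forall k i, (k <= n)%N -> (i <= n)%N ->
    exists w, redirects n y k i w /\ forall l, (l <= n)%N -> v l + w \in A.

Lemma protects_exists n y : exists A, protects n y A.
Proof.
have /choice[w wP] : forall p : nat * nat, exists w,
    (p.1 <= n)%N -> redirects n y p.1 p.2 w.
  move=> [k i] /=; have [kn|nk] := boolP (k <= n)%N; last by exists 0.
  by have [w ?] := redirects_exists y i kn; exists w.
pose I := iota 0 n.+1.
have inI l : (l <= n)%N -> l \in I by move=> ln; rewrite mem_iota.
exists (map v I ++ [seq v l + w p | l <- I, p <- [seq (k, i) | k <- I, i <- I]]).
split=> [l ln|k i kn i_n]; first by rewrite mem_cat map_f // inI.
exists (w (k, i)); split; first exact: (wP (k, i)).
move=> l ln; rewrite mem_cat; apply/orP; right.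
apply: (allpairs_f (fun l p => v l + w p)); first exact: inI.
by apply: (allpairs_f pair); apply: inI.
Qed.

(* Along the branch [y] the values at the translates in [A n] rise by at most
   [2 * dyadic n] from level [sg n] on. *)
Definition controlled_branch (y : nat -> G) (A : nat -> seq G) : Prop :=
  [/\ forall n, protects n (y n) (A n),
      forall n, {subset A n <= A n.+1},
      forall n, y n.+1 + c (sg n.+1) (sg n) =[sg n] y n
    & forall n a, a \in A n ->
        f (sg n.+1) (a + y n.+1) <= f (sg n) (a + y n) + dyadic n].

Lemma controlled_branch_exists : exists y A, controlled_branch y A.
Proof.
have /choice[P protectsP] : forall p : nat * G, exists A, protects p.1 p.2 A.
  by move=> p; apply: protects_exists.
have /choice[Y liftP] : forall p : nat * G * seq G, exists y,
    y + c (sg p.1.1.+1) (sg p.1.1) =[sg p.1.1] p.1.2 /\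
    forall a, a \in p.2 ->
      f (sg p.1.1.+1) (a + y) <= f (sg p.1.1) (a + p.1.2) + dyadic p.1.1.
  by move=> p; apply: stage_lift; rewrite ?sg_homo ?dyadic_gt0.
pose fix branch n := if n is m.+1 then
    (let y := Y (m, (branch m).1, (branch m).2) in (y, (branch m).2 ++ P (m.+1, y)))
  else (0, P (0%N, 0)).
exists (fun n => (branch n).1), (fun n => (branch n).2); split.
- case=> [|n] /=; first exact: (protectsP (0%N, 0)).
  have [vP redirectP] := protectsP (n.+1, Y (n, (branch n).1, (branch n).2)).
  split=> [l ln|k i kn i_n]; first by rewrite mem_cat vP ?orbT.
  have [w [w_redirects wP]] := redirectP _ _ kn i_n; exists w; split=> // l ln.
  by rewrite mem_cat wP ?orbT.
- by move=> n a /= an; rewrite mem_cat an.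
- by move=> n; case: (liftP (n, (branch n).1, (branch n).2)).
- by move=> n a; case: (liftP (n, (branch n).1, (branch n).2)) => _; apply.
Qed.

Section Branch.
Variables (y : nat -> G) (A : nat -> seq G).
Hypothesis branchP : controlled_branch y A.

Definition height n x := f (sg n) (x + y n).

Lemma height_cong n x x' : x =[d] x' -> height n x = height n x'.
Proof.
move=> xx'; apply: stage_cong (sg_lt n) _; apply: congDr.
by apply: cong_le xx'; apply: ltW.
Qed.

Lemma height_homo x : {homo height^~ x : m n / (m <= n)%N >-> m <= n}.
Proof.
apply: homo_leq => [//|? ? ?|n]; first exact: le_trans.
rewrite /height -(@stage_cong (sg n) (x + y n.+1 + c (sg n.+1) (sg n))) //.
  by apply: stage_transition_le; rewrite ?sg_homo.
by rewrite -addrA; apply: congDl; case: branchP => _ _ + _; apply.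
Qed.

Lemma height_protected x n m : x \in A n -> (n <= m)%N ->
  height m x <= height n x + 2 * dyadic n.
Proof.
have [_ A_sub _ y_step] := branchP.
move=> xA /subnK <-; set k := (m - n)%N.
suff [] : x \in A (k + n)%N /\
    height (k + n)%N x + 2 * dyadic (k + n) <= height n x + 2 * dyadic n.
  by have := dyadic_gt0 (k + n); lra.
elim: k => [|k [xAk IH]] //; rewrite addSn; split; first exact: A_sub.
by have := y_step _ _ xAk; rewrite -/(height _ _) -/(height _ _) dyadicS; lra.
Qed.

Lemma height_bounded l n : height n (v l) <= height l (v l) + 2 * dyadic l.
Proof.
have [nl|ln] := leqP n l.
  by have := height_homo (v l) nl; have := dyadic_gt0 l; lra.
by apply: height_protected (ltnW ln); case: branchP => /(_ l)[+ _] _ _ _; apply.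
Qed.

Lemma limit_value_exists : exists fd : G -> rat,
  [/\ forall x x', x =[d] x' -> fd x = fd x',
      forall x n, height n x < fd x
    & forall x, exists l n, x =[d] v l /\ fd x <= height n x + dyadic l].
Proof.
have /choice[q qP] : forall l, exists q,
    (forall n, height n (v l) < q) /\ (exists n, q <= height n (v l) + dyadic l).
  by move=> l; apply: strict_upper_bound_near (dyadic_gt0 l) (height_bounded l).
have v_dense_bool x : exists l, `[< x =[d] v l >].
  by have [l xl] := v_dense x; exists l; apply/asboolP.
pose idx x := ex_minn (v_dense_bool x).
have idxP x : x =[d] v (idx x) by rewrite /idx; case: ex_minnP => l /asboolP.
have idx_min x l : x =[d] v l -> (idx x <= l)%N.
  by move=> xl; rewrite /idx; case: ex_minnP => m _; apply; apply/asboolP.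
exists (q \o idx); split=> [x x' xx'|x n|x] /=.
- congr q; apply/eqP; rewrite eqn_leq; apply/andP; split; apply: idx_min.
    exact: cong_trans xx' (idxP x').
  exact: cong_trans (cong_sym xx') (idxP x).
- by rewrite (height_cong _ (idxP x)); case: (qP (idx x)).
- have [_ [n]] := qP (idx x); rewrite -(height_cong _ (idxP x)) => q_le.
  by exists (idx x), n.
Qed.

Lemma branch_transition s m n : (s <= sg m)%O -> (m <= n)%N ->
  y n + c (sg n) s =[s] y m + c (sg m) s.
Proof.
move=> sm mn; have snm : (sg m <= sg n)%O := sg_homo mn.
apply: (@cong_trans _ (y n + (c (sg n) (sg m) + c (sg m) s))).
  exact/congDl/cong_sym/transition_coherent.
rewrite addrA; apply: congDr; apply: cong_le sm _ => {snm}.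
elim: n mn => [|n IH].
  by rewrite leqn0 => /eqP ->; rewrite transition_refl // addr0.
rewrite leq_eqVlt ltnS => /predU1P[->|mn].
  by rewrite transition_refl // addr0.
apply: cong_trans (IH mn); have nm := sg_homo mn.
apply: (@cong_trans _ (y n.+1 + (c (sg n.+1) (sg n) + c (sg n) (sg m)))).
  by apply/congDl/cong_sym/transition_coherent; rewrite ?sg_homo.
rewrite addrA; apply: congDr; apply: cong_le nm _.
by case: branchP => _ _ + _; apply.
Qed.

Lemma limit_transition_exists : exists cd : L -> G,
  cd d = 0 /\ forall s m, (s <= sg m)%O -> cd s =[s] y m + c (sg m) s.
Proof.
have /choice[nu nuP] : forall s, exists n, (s < d)%O -> (s <= sg n)%O.
  move=> s; have [/sg_cofinal[n ?]|] := boolP (s < d)%O; first by exists n.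
  by exists 0%N.
exists (fun s => if s == d then 0 else y (nu s) + c (sg (nu s)) s).
split=> [|s m sm]; first by rewrite eqxx.
have sd : (s < d)%O := le_lt_trans sm (sg_lt m).
rewrite lt_eqF //; have [mn|/ltnW nm] := leqP m (nu s); first exact: branch_transition.
exact/cong_sym/branch_transition/nm/nuP.
Qed.

Variables (cd : L -> G) (fd : G -> rat).
Hypothesis cd_branch : forall s m, (s <= sg m)%O -> cd s =[s] y m + c (sg m) s.
Hypothesis fd_cong : forall x x', x =[d] x' -> fd x = fd x'.
Hypothesis fd_gt : forall x n, height n x < fd x.
Hypothesis fd_near : forall x, exists l n, x =[d] v l /\ fd x <= height n x + dyadic l.

Lemma limit_coherent s t : (s <= t)%O -> (t < d)%O -> cd t + c t s =[s] cd s.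
Proof.
move=> st td; have [m tm] := sg_cofinal td.
apply: cong_trans (cong_sym (cd_branch (le_trans st tm))).
apply: (@cong_trans _ (y m + c (sg m) t + c t s)).
  by apply: congDr; apply: cong_le st _; apply: cd_branch.
by rewrite -addrA; apply: congDl; apply: transition_coherent.
Qed.

Lemma limit_lt s x : (s < d)%O -> f s (x + cd s) < fd x.
Proof.
move=> sd; have [m sm] := sg_cofinal sd; apply: le_lt_trans (fd_gt x m).
rewrite (@stage_cong s _ (x + y m + c (sg m) s)) ?stage_transition_le //.
by rewrite -addrA; apply/congDl/cd_branch.
Qed.

Lemma finitely_many_classes (F : seq G) :
  exists N, forall b, b \in F -> exists l, (l <= N)%N /\ b =[d] v l.
Proof.
elim: F => [|b F [N NP]]; first by exists 0%N.
have [l bl] := v_dense b; exists (maxn N l) => b'; rewrite inE => /predU1P[->|].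
  by exists l; rewrite leq_maxr.
by move=> /NP[l' [l'N ?]]; exists l'; rewrite leq_max l'N.
Qed.

Lemma redirect_value_le n k i w l : redirects n (y n) k i w -> (l <= n)%N ->
  v l + w \in A n -> fd (v l + w) <= f (sg k) (v l + v i) + 4 * dyadic n.
Proof.
move=> [_ w_low w_avoids] ln wA; have [j [m [wj fd_le]]] := fd_near (v l + w).
have nj : (n < j)%N by rewrite ltnNge; apply/negP => jn; apply: w_avoids wj.
have := dyadic_le (ltnW nj); have := w_low _ ln; rewrite -/(height n _).
have := height_homo (v l + w) (leq_maxr n m).
by have := height_protected wA (leq_maxl n m); lra.
Qed.

Lemma limit_lift s x (F : seq G) e : (s < d)%O -> 0 < e ->
  exists w, w + cd s =[s] x /\ forall a, a \in F -> fd (a + w) <= f s (a + x) + e.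
Proof.
move=> sd e_gt0; have [k sk] := sg_cofinal sd.
have [|z [zK zf]] := stage_lift x F sk (sg_lt k) (e := e / 2); first by lra.
have [i zi] := v_dense z; have [N NP] := finitely_many_classes F.
have [|j je] := @dyadic_small (e / 8); first by lra.
pose n := maxn (maxn k i) (maxn j N).
have := leqnn n; rewrite {1}/n !geq_max => /andP[/andP[kn i_n] /andP[jn Nn]].
have [/(_ n)[_ /(_ k i kn i_n)[w [w_redirects wA]]] _ _ _] := branchP.
have ck x1 x2 : x1 =[d] x2 -> x1 =[sg k] x2 by apply: cong_le; apply: ltW.
exists w; split=> [|a aF].
  have skn : (sg k <= sg n)%O := sg_homo kn.
  apply: (@cong_trans _ (w + y n + (c (sg n) (sg k) + c (sg k) s))).
    rewrite -addrA; apply: congDl; apply: cong_trans (cd_branch (le_trans sk skn)) _.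
    exact/congDl/cong_sym/transition_coherent.
  rewrite addrA; apply: cong_trans zK; apply: congDr; apply: cong_le sk _.
  by case: w_redirects => [/cong_trans + _ _]; apply; apply/cong_sym/ck.
have [l [lN al]] := NP _ aF; have ln := leq_trans lN Nn.
rewrite (fd_cong (congDr w al)).
have := redirect_value_le w_redirects ln (wA _ ln); have := dyadic_le jn.
by rewrite -(stage_cong _ (ck _ _ (congD al zi))) //; have := zf _ aF; lra.
Qed.

End Branch.

Lemma stage_exists : exists cd fd, stage d c f cd fd.
Proof.
have [y [A branchP]] := controlled_branch_exists.
have [fd [fd_cong fd_gt fd_near]] := limit_value_exists branchP.
have [cd [cd_d cd_branch]] := limit_transition_exists branchP.
exists cd, fd; split=> //.
- exact: limit_coherent cd_branch.
- exact: limit_lt cd_branch fd_gt.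
- exact: limit_lift branchP _ _ cd_branch fd_cong fd_near.
Qed.

End StageStep.

Theorem coherent_specialization : exists (c : L -> L -> G) (f : L -> G -> rat),
  [/\ forall s t u, (s < t)%O -> (t < u)%O -> c u t + c t s =[s] c u s,
      forall s x y, x =[s] y -> f s x = f s y
    & forall s t x, (s < t)%O -> f s (x + c t s) < f t x].
Proof.
pose T := ((L -> G) * (G -> rat))%type.
pose stageT d (D : L -> T) (p : T) :=
  stage d (fun t => (D t).1) (fun t => (D t).2) p.1 p.2.
have [||D stages] := @well_founded_construction L T _ (fun=> 0, fun=> 0) stageT L_wf.
- move=> d D D' p DD' [cd_d cd_coh fd_cong fd_lt fd_lift]; split=> //.
  + by move=> s t st td; rewrite -DD' //; apply: cd_coh.
  + by move=> s x sd; rewrite -DD' //; apply: fd_lt.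
  + by move=> s x F e sd e_gt0; rewrite -DD' //; apply: fd_lift.
- move=> d D prev; have [[s0 s0d]|d_min] := pselect (exists s, (s < d)%O).
    have [sg [sg_lt sg_homo sg_cofinal]] := cofinal_sequence (L_countable d) s0d.
    have [v v_dense] := K_countable d.
    have [cd [fd ?]] := stage_exists prev sg_lt sg_homo sg_cofinal v_dense.
    by exists (cd, fd).
  have below s : ~ (s < d)%O by move=> sd; apply: d_min; exists s.
  by exists (fun=> 0, fun=> 0); split=> // [s t _|s x|s x F e] /below.
exists (fun t => (D t).1), (fun t => (D t).2); split.
- by move=> s t u st tu; case: (stages u) => _ + _ _ _; apply=> //; apply: ltW.
- by move=> s x y; case: (stages s) => _ _ + _ _; apply.
- by move=> s t x st; case: (stages t) => _ _ _ + _; apply.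
Qed.

End CoherentSpecialization.

(** * Limit levels of the first uncountable ordinal *)

Lemma countable_setP (T : Type) (P : T -> Prop) :
  countable_set P <-> countable [set x | P x].
Proof.
split=> [[e eP]|/countable_injP[h h_inj]].
  have /choice[h hP] : forall x, exists n, P x -> e n = Some x.
    by move=> x; have [/eP[n ?]|] := pselect (P x); [exists n|exists 0%N].
  apply/countable_injP; exists h => x y /set_mem/hP ex /set_mem/hP ey hxy.
  by move: ex; rewrite hxy ey => -[].
have /choice[e eP] : forall n, exists o, forall x, P x -> h x = n -> o = Some x.
  move=> n; have [[x [Px hx]]|none] := pselect (exists x, P x /\ h x = n).
    by exists (Some x) => y Py hy; congr Some; apply: h_inj; rewrite ?inE ?hx ?hy.
  by exists None => x Px hx; case: none; exists x.
by exists e => x Px; exists (h x); apply: eP.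
Qed.

Lemma countable_set_preimage (T T' : Type) (h : T -> T') (P : T' -> Prop) :
  injective h -> countable_set P -> countable_set (fun x => P (h x)).
Proof.
move=> h_inj /countable_setP/countable_injP[k k_inj].
apply/countable_setP/countable_injP; exists (k \o h) => x y /set_mem Px /set_mem Py.
by move=> /k_inj; rewrite !inE => /(_ Px Py)/h_inj.
Qed.

Section LimitLevels.
Context (disp : Order.disp_t) (W : orderType disp).
Hypothesis W_omega1 : omega1_order (fun x y : W => x < y)%O.

Lemma omega1_wf : well_founded (fun x y : W => x < y)%O.
Proof. by case: W_omega1 => _ [_ [_ []]]. Qed.

Lemma omega1_countable (d : W) : countable_set (fun x => x < d)%O.
Proof. by case: W_omega1 => _ [_ [_ [_ []]]]. Qed.

Lemma omega1_countable_le (d : W) : countable_set (fun x => x <= d)%O.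
Proof.
have [e eP] := omega1_countable d.
exists (fun n => if n is m.+1 then e m else Some d) => x.
by rewrite le_eqVlt => /predU1P[->|/eP[n en]]; [exists 0%N|exists n.+1].
Qed.

Lemma omega1_bounded (e : nat -> W) : exists t, forall n, (e n < t)%O.
Proof.
apply: contrapT => /forallNP unbounded.
case: W_omega1 => _ [_ [_ [_ [_]]]]; apply; apply/countable_setP.
have W_covered : [set: W] `<=` \bigcup_n [set x | (x <= e n)%O].
  move=> x _; apply: contrapT => x_above; apply: (unbounded x) => n.
  by rewrite ltNge; apply/negP => xn; apply: x_above; exists n.
apply: sub_countable (subset_card_le W_covered) _.
by apply: bigcup_countable => // n _; apply/countable_setP/omega1_countable_le.
Qed.

Definition gap (s t : W) : set W := [set x | (s <= x < t)%O].

Lemma gap_sub s s' t t' : (s' <= s)%O -> (t <= t')%O -> gap s t `<=` gap s' t'.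
Proof.
by move=> ss tt x /andP[sx xt]; rewrite /gap /= (le_trans ss sx) (lt_le_trans xt tt).
Qed.

Lemma infinite_gap s : exists t, infinite_set (gap s t).
Proof.
have /choice[next nextP] : forall x : W, exists y, (x < y)%O.
  by move=> x; have [y xy] := omega1_bounded (fun=> x); exists y; apply: xy 0%N.
pose e n := iter n next s.
have e_lt : {homo e : m n / (m < n)%N >-> (m < n)%O}.
  apply: homo_ltn => [? ? ?|n]; [exact: lt_trans|exact: nextP].
have e_inj : injective e.
  by move=> m n emn; apply/eqP; case: ltngtP => // /e_lt; rewrite emn ltxx.
have [t et] := omega1_bounded e; exists t => fin_gap; apply: infinite_nat.
rewrite (_ : setT = e @^-1` gap s t).
  exact: card_le_finite (card_ge_preimage (in2W e_inj)) fin_gap.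
apply/esym/seteqP; split=> // n _; rewrite /gap /= et andbT.
by case: n => [|n]; [exact: lexx|exact/ltW/(@e_lt 0%N)].
Qed.

Variable g : W.

Definition limit_level : pred W := fun s =>
  `[< (g <= s)%O /\ forall x, (g <= x < s)%O -> infinite_set (gap x s) >].

Definition level : Type := {s : W | limit_level s}.
HB.instance Definition _ := SubType.on level.
HB.instance Definition _ := [Order of level by <:].

Implicit Types l m : level.

Lemma level_wf : well_founded (fun l m => l < m)%O.
Proof. exact: (Inverse_Image.wf_inverse_image _ _ _ val omega1_wf). Qed.

Lemma level_countable m : countable_set (fun l => l < m)%O.
Proof. exact: countable_set_preimage val_inj (omega1_countable (val m)). Qed.

Lemma level_ge l : (g <= val l)%O.
Proof. by have /asboolP[] := valP l. Qed.

Lemma level_infinite_gap l m : (l < m)%O -> infinite_set (gap (val l) (val m)).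
Proof. by move=> lm; have /asboolP[_] := valP m; apply; rewrite level_ge. Qed.

Lemma last_level_exists s : (g <= s)%O ->
  exists l, (val l <= s)%O /\ finite_set (gap (val l) s).
Proof.
elim/(well_founded_ind omega1_wf): s => s IH gs.
have [s_lim|s_succ] := boolP (limit_level s).
  exists (exist _ s s_lim); split=> //=; apply: sub_finite_set (finite_set0 _).
  by move=> x /andP[sx] /=; rewrite ltNge sx.
have [x [/andP[gx xs] fin_xs]] : exists x, (g <= x < s)%O /\ finite_set (gap x s).
  apply: contrapT => none; move/asboolPn: s_succ; apply; split=> // x gxs fin_xs.
  by apply: none; exists x.
have [l [lx fin_lx]] := IH _ xs gx.
exists l; split; first exact: le_trans lx (ltW xs).
have gap_split : gap (val l) s `<=` gap (val l) x `|` gap x s.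
  move=> y /andP[ly ys]; have [yx|xy] := ltP y x; first by left; rewrite /gap /= ly.
  by right; rewrite /gap /= xy.
by apply: sub_finite_set gap_split _; rewrite finite_setU.
Qed.

Lemma level_cofinal s : exists l, (s < val l)%O.
Proof.
have [t t_inf] := infinite_gap (Order.max g s).
have [|l [l_below fin_lt]] := @last_level_exists t.
  have [x /andP[+ xt]] := infinite_setN0 t_inf; rewrite ge_max => /andP[gx _].
  exact: le_trans gx (ltW xt).
exists l; rewrite ltNge; apply/negP => ls; apply: t_inf.
by apply: sub_finite_set (gap_sub _ (lexx t)) fin_lt; rewrite le_max ls orbT.
Qed.

Lemma level_unbounded l : exists m, (l < m)%O.
Proof. exact: level_cofinal (val l). Qed.

Lemma last_levels_exist : exists (last : W -> level) (idx : W -> nat),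
  (forall s, (g <= s)%O -> (val (last s) <= s)%O) /\
  forall s t, (g <= s)%O -> (s < t)%O ->
    (last s < last t)%O \/ last s = last t /\ idx s <> idx t.
Proof.
have [l0 _] := level_cofinal g.
have /choice[last lastP] : forall s, exists l, (g <= s)%O ->
    (val l <= s)%O /\ finite_set (gap (val l) s).
  move=> s; have [/last_level_exists[l ?]|] := boolP (g <= s)%O; first by exists l.
  by exists l0.
have /choice[next nextP] := level_cofinal.
have /choice[enum enumP] : forall d : W, exists h : W -> nat,
    {in [set x | (x < d)%O] &, injective h}.
  by move=> d; apply/countable_injP/countable_setP/omega1_countable.
have lt_next s : (g <= s)%O -> (s < val (next (val (last s))))%O.
  move=> /lastP[_ fin_s]; rewrite ltNge; apply/negP => next_s.
  apply: (@level_infinite_gap (last s) (next (val (last s)))) (nextP _) _.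
  exact: sub_finite_set (gap_sub (lexx _) next_s) fin_s.
exists last, (fun s => enum (val (next (val (last s)))) s); split.
  by move=> s /lastP[].
move=> s t gs st; have gt := le_trans gs (ltW st).
case: (ltgtP (last s) (last t)) => [|ts|st_eq]; [by left| |right; split=> //].
  have [_ fin_t] := lastP t gt; case: (level_infinite_gap ts).
  apply: sub_finite_set (gap_sub (lexx _) _) fin_t.
  by have [s_ge _] := lastP s gs; apply: le_trans s_ge (ltW st).
rewrite st_eq => /enumP; rewrite !inE /= -{1}st_eq !lt_next // => /(_ isT isT) E.
by rewrite E ltxx in st.
Qed.

End LimitLevels.

(** * Units of valuation domains *)

Section Divisibility.
Variable R : idomainType.
Implicit Types a b g k m p u x y : R.

Lemma dvd_refl a : dvd a a.
Proof. by exists 1; rewrite mulr1. Qed.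
#[local] Hint Resolve dvd_refl : core.

Lemma dvd_trans a b x : dvd a b -> dvd b x -> dvd a x.
Proof. by move=> [s ->] [t ->]; exists (s * t); rewrite mulrA. Qed.

Lemma dvd0 a : dvd a 0.
Proof. by exists 0; rewrite mulr0. Qed.

Lemma dvdD a x y : dvd a x -> dvd a y -> dvd a (x + y).
Proof. by move=> [s ->] [t ->]; exists (s + t); rewrite mulrDr. Qed.

Lemma dvdN a x : dvd a x -> dvd a (- x).
Proof. by move=> [s ->]; exists (- s); rewrite mulrN. Qed.

Lemma dvdB a x y : dvd a x -> dvd a y -> dvd a (x - y).
Proof. by move=> ax ay; apply/dvdD/dvdN. Qed.

Lemma dvd_subC a x y : dvd a (x - y) -> dvd a (y - x).
Proof. by rewrite -[y - x]opprB; apply: dvdN. Qed.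

Lemma dvd_mulr a x y : dvd a x -> dvd a (x * y).
Proof. by move=> [s ->]; exists (s * y); rewrite mulrA. Qed.

Lemma dvd_mull a x y : dvd a x -> dvd a (y * x).
Proof. by rewrite mulrC; apply: dvd_mulr. Qed.

Lemma dvd1P x : dvd x 1 <-> x \is a GRing.unit.
Proof.
split=> [[y xy]|ux]; last by exists x^-1; rewrite divrr.
by apply/unitrPr; exists y.
Qed.

Lemma dvd_unit_mull a u x : u \is a GRing.unit -> dvd a (u * x) -> dvd a x.
Proof. by move=> uu /(dvd_mull u^-1); rewrite mulKr. Qed.

Definition residue_rep g x : R := choose (fun y => `[< dvd g (x - y) >]) x.

Lemma dvd_residue_rep g x : dvd g (x - residue_rep g x).
Proof.
apply: asboolW; apply: (@chooseP _ (fun y => `[< dvd g (x - y) >])).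
by apply/asboolP; rewrite subrr; apply: dvd0.
Qed.

Lemma eq_residue_rep g x y : dvd g (x - y) -> residue_rep g x = residue_rep g y.
Proof.
move=> gxy; have dvd_sub z : `[< dvd g (x - z) >] = `[< dvd g (y - z) >].
  apply: asbool_equiv_eq; split=> gz.
    by rewrite -(subrKA x); apply: dvdD gz; apply: dvd_subC.
  by rewrite -(subrKA y); apply: dvdD gz.
rewrite /residue_rep (eq_choose dvd_sub); apply: choose_id; apply/asboolP.
  exact: dvd_subC.
by rewrite subrr; apply: dvd0.
Qed.

Hypothesis R_val : valuation_domain R.

Lemma dvd_total a b : dvd a b \/ dvd b a.
Proof.
have idl x : is_ideal (dvd x).
  by split=> [|y z|s y]; [exact: dvd0|exact: dvdD|exact: dvd_mull].
by case: (R_val (idl a) (idl b)) => sub; [right|left]; apply: sub.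
Qed.

Lemma unit_congr g u x : ~ dvd g 1 -> u \is a GRing.unit -> dvd g (x - u) ->
  x \is a GRing.unit.
Proof.
move=> g_nonunit uu gxu; have uE : u * 1 = x - (x - u) by rewrite mulr1 subKr.
apply/dvd1P; case: (dvd_total x g) => [xg|gx].
  apply: dvd_unit_mull uu _; rewrite uE; apply: dvdB => //; exact: dvd_trans gxu.
by case: g_nonunit; apply: dvd_unit_mull uu _; rewrite uE; apply: dvdB.
Qed.

Lemma unit_of_dvd_cancel p k : p != 0 -> ~ dvd p 1 ->
  (forall m, dvd p (k * m) -> dvd p m) -> k \is a GRing.unit.
Proof.
move=> p_neq0 p_nonunit cancel_k; apply/dvd1P; case: (dvd_total p k) => [pk|[m pE]].
  by case: p_nonunit; apply: cancel_k; apply: dvd_mulr.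
have [n mE] : dvd p m by apply: cancel_k; rewrite -pE.
by exists n; apply: (mulfI p_neq0); rewrite mulr1 [LHS]pE mE mulrCA.
Qed.

Definition principal_unit_epi g (G : zmodType) (j : G -> R) : Prop :=
  [/\ j 0 = 1, forall x y : G, j (x + y) = j x * j y,
      forall x : G, dvd g (j x - 1) & forall y, dvd g (y - 1) -> exists x : G, j x = y].

(* The group law on [R] is transported along [x |-> 1 + g x]. *)
Lemma principal_unit_group g : ~ dvd g 1 ->
  exists (G : zmodType) (j : G -> R), principal_unit_epi g j.
Proof.
move=> g_nonunit; pose j x := 1 + g * x.
have ju x : j x \is a GRing.unit.
  apply: (unit_congr g_nonunit (unitr1 R)).
  by rewrite /j addrAC subrr add0r; exists x.
pose op x y := x + y + g * x * y.
have opA : associative op by move=> x y z; rewrite /op; ring.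
have opC : commutative op by move=> x y; rewrite /op; ring.
have op0 : left_id 0 op by move=> x; rewrite /op; ring.
have opN : left_inverse 0 (fun x => - x / j x) op.
  move=> x; apply: (mulIr (ju x)); rewrite mul0r /op.
  have -> : (- x / j x + x + g * (- x / j x) * x) * j x =
    - x / j x * j x * (1 + g * x) + x * j x by ring.
  by rewrite divrK // /j; ring.
pose zm := GRing.isZmodule.Build R opA opC op0 opN.
pose Z : zmodType := HB.pack (R : Type) (Choice.on R) zm.
exists Z, j; split.
- by rewrite /j mulr0 addr0.
- by move=> x y; rewrite -[(x + y)%R]/(op x y) /j /op; ring.
- by move=> x; rewrite /j addrAC subrr add0r; exists x.
- by move=> y [x yx]; exists x; rewrite /j -yx addrC subrK.
Qed.

End Divisibility.
#[local] Hint Resolve dvd_refl dvd0 : core.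

Definition divisor_chain (disp : Order.disp_t) (W : orderType disp) (R : idomainType)
    (r : W -> R) : Prop :=
  forall s t, (s < t)%O -> dvd (r s) (r t) /\ ~ dvd (r t) (r s).

Section UnitCocycles.
Context (disp : Order.disp_t) (L : orderType disp) (R : idomainType).
Variables (p : L -> R) (c : L -> L -> R).

Definition unit_cocycle : Prop :=
  (forall s t, c s t \is a GRing.unit) /\
  forall s t u, (s < t)%O -> (t < u)%O -> dvd (p s) (c u t * c t s - c u s).

(* The units modulo [p s], for all [s], form a tree in which [x] at level [t] lies
   above [c t s * x]; [f] is a strictly increasing map on it. *)
Definition specializes (f : L -> R -> rat) : Prop :=
  (forall s x y, x \is a GRing.unit -> dvd (p s) (x - y) -> f s x = f s y) /\
  forall s t x, (s < t)%O -> x \is a GRing.unit -> f s (c t s * x) < f t x.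

End UnitCocycles.

Section SpecializedCocycle.
Context (disp : Order.disp_t) (W : orderType disp) (R : idomainType).
Variable r : W -> R.
Hypothesis R_val : valuation_domain R.
Hypothesis W_omega1 : omega1_order (fun x y : W => x < y)%O.
Hypothesis r_chain : divisor_chain r.

Lemma chain_dvd s t : (s <= t)%O -> dvd (r s) (r t).
Proof. by rewrite le_eqVlt => /predU1P[->//|/r_chain[]]. Qed.

Lemma chain_sub_inj t x y : (x < t)%O -> (y < t)%O -> dvd (r t) (r x - r y) -> x = y.
Proof.
wlog xy : x y / (x <= y)%O => [sym xt yt txy|_ yt txy].
  have [xy|yx] := leP x y; first exact: sym.
  by apply/esym/sym => //; [apply: ltW|apply: dvd_subC].
move: xy; rewrite le_eqVlt => /predU1P[//|/r_chain[_ []]].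
rewrite -[r x](subrK (r y)); apply: dvdD => //.
exact: dvd_trans (chain_dvd (ltW yt)) txy.
Qed.

Lemma chain_nonunit s t : (s < t)%O -> ~ dvd (r t) 1.
Proof.
move=> /r_chain[_ ts] t1; apply: ts; apply: dvd_trans t1 _.
by rewrite -[r s]mul1r; apply: dvd_mulr.
Qed.

Variables (g0 g : W).
Hypothesis g0g : (g0 < g)%O.
Hypothesis r_countable : forall s, (g0 < s)%O -> exists h : nat -> R,
  forall x, dvd (r g0) x -> exists n, dvd (r s) (x - h n).

Lemma base_nonunit : ~ dvd (r g) 1.
Proof. exact: chain_nonunit g0g. Qed.

Lemma level_nonunit (s : level g) : ~ dvd (r (val s)) 1.
Proof. exact: chain_nonunit (lt_le_trans g0g (level_ge s)). Qed.

Section Congruence.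
Variables (G : zmodType) (j : G -> R).
Hypothesis j_epi : principal_unit_epi (r g) j.

Lemma principal_unit_epi0 : j 0 = 1. Proof. by case: j_epi. Qed.

Lemma principal_unit_epiD x y : j (x + y) = j x * j y. Proof. by case: j_epi. Qed.

Lemma principal_unit_epi_unit x : j x \is a GRing.unit.
Proof.
by case: j_epi => _ _ j1 _; apply: (unit_congr R_val base_nonunit (unitr1 R) (j1 x)).
Qed.

Definition level_subgroup (s : level g) (x : G) : Prop := dvd (r (val s)) (j x - 1).

Lemma level_subgroup_subE s x y :
  level_subgroup s (x - y) <-> dvd (r (val s)) (j x - j y).
Proof.
have -> : j x - j y = j y * (j (x - y) - 1).
  by rewrite mulrBr mulr1 -principal_unit_epiD [y + _]addrC subrK.
split; first exact: dvd_mull.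
exact: dvd_unit_mull (principal_unit_epi_unit y).
Qed.

Lemma level_subgroup0 s : level_subgroup s 0.
Proof. by rewrite /level_subgroup principal_unit_epi0 subrr. Qed.

Lemma level_subgroupB s x y :
  level_subgroup s x -> level_subgroup s y -> level_subgroup s (x - y).
Proof.
move=> Kx Ky; apply/level_subgroup_subE.
by rewrite -(subrKA 1) -[1 - _]opprB; apply: dvdB.
Qed.

Lemma level_subgroup_le s t x :
  (s <= t)%O -> level_subgroup t x -> level_subgroup s x.
Proof. by move=> st; apply/dvd_trans/chain_dvd. Qed.

Lemma level_subgroup_countable s :
  exists v : nat -> G, forall x, exists n, level_subgroup s (x - v n).
Proof.
have [h hP] := r_countable (lt_le_trans g0g (level_ge s)).
have /choice[v vP] : forall n, exists y, forall x,
    dvd (r (val s)) (j x - 1 - h n) -> level_subgroup s (x - y).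
  move=> n; have [[y yP]|none] := pselect (exists y, dvd (r (val s)) (j y - 1 - h n)).
    exists y => x xP; apply/level_subgroup_subE.
    have -> : j x - j y = (j x - 1 - h n) - (j y - 1 - h n) by ring.
    exact: dvdB.
  by exists 0 => x xP; case: none; exists x.
exists v => x; have [|n nP] := hP (j x - 1); last by exists n; apply: vP.
by apply: dvd_trans (chain_dvd (ltW g0g)) _; case: j_epi.
Qed.

Lemma level_subgroup_infinite s t (B : seq G) : (s < t)%O ->
  exists x, level_subgroup s (x - 0) /\ forall b, b \in B -> ~ level_subgroup t (x - b).
Proof.
move=> st; apply: contrapT => none; apply: (level_infinite_gap st).
have /choice[u uP] : forall x, exists y, (g <= x)%O -> j y = 1 + r x.
  move=> x; have [gx|] := boolP (g <= x)%O; last by exists 0.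
  case: j_epi => _ _ _ /(_ (1 + r x))[|y yE]; last by exists y.
  by rewrite addrC addKr; apply: chain_dvd.
have gap_ge x : gap (val s) (val t) x -> (g <= x)%O.
  by move=> /andP[sx _]; apply: le_trans (level_ge s) sx.
have /choice[beta betaP] : forall x, exists b, gap (val s) (val t) x ->
    b \in B /\ level_subgroup t (u x - b).
  move=> x; have [xP|] := pselect (gap (val s) (val t) x); last by exists 0.
  apply: contrapT => no_b; apply: none; exists (u x); split=> [|b bB Kb].
    rewrite subr0 /level_subgroup uP ?gap_ge // addrC addKr.
    by apply: chain_dvd; case/andP: xP.
  by apply: no_b; exists b.
have beta_inj : {in gap (val s) (val t) &, injective beta}.
  move=> x y /set_mem xP /set_mem yP bxy.
  apply: (@chain_sub_inj (val t)); [by case/andP: xP|by case/andP: yP|].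
  have [_ Kx] := betaP _ xP; have [_ Ky] := betaP _ yP.
  have := level_subgroupB Kx Ky; rewrite bxy opprB subrKA => /level_subgroup_subE.
  by rewrite !uP ?gap_ge // opprD addrACA subrr add0r.
rewrite -(eq_finite_set (inj_card_eq beta_inj)).
apply: sub_finite_set (finite_seq B) => _ [x /betaP[bB _] <-]; exact: bB.
Qed.

(* Dividing by [residue_rep] brings every unit into [1 + gR]. *)
Lemma normalization_exists : exists norm : R -> G, forall x,
  x \is a GRing.unit -> j (norm x) = x / residue_rep (r g) x.
Proof.
suff /choice[norm normP] : forall x, exists y,
  x \is a GRing.unit -> j y = x / residue_rep (r g) x by exists norm.
move=> x; have [ux|] := boolP (x \is a GRing.unit); last by exists 0.
have ur : residue_rep (r g) x \is a GRing.unit.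
  exact: (unit_congr R_val base_nonunit ux (dvd_subC (dvd_residue_rep _ _))).
case: j_epi => _ _ _ /(_ (x / residue_rep (r g) x))[|y yE]; last by exists y.
by rewrite -(divrr ur) -mulrBl; apply/dvd_mulr/dvd_residue_rep.
Qed.

End Congruence.

Theorem specialized_cocycle_exists : exists (c : level g -> level g -> R) f,
  unit_cocycle (fun s : level g => r (val s)) c /\
  specializes (fun s : level g => r (val s)) c f.
Proof.
have [G [j j_epi]] := principal_unit_group R_val base_nonunit.
have [c [f [c_coh f_cong f_lt]]] := coherent_specialization
  (level_subgroup0 j_epi) (level_subgroupB j_epi) (@level_subgroup_le _ j)
  (level_wf W_omega1 (g := g)) (level_countable W_omega1 (g := g))
  (level_subgroup_countable j_epi) (level_subgroup_infinite j_epi).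
have [norm normP] := normalization_exists j_epi.
have ju := principal_unit_epi_unit j_epi.
exists (fun t s => j (c t s)), (fun s x => f s (norm x)); split; split=> //.
- move=> s t u st tu; rewrite -(principal_unit_epiD j_epi).
  by apply/(level_subgroup_subE j_epi); apply: c_coh.
- move=> s x y ux xy; have gxy := dvd_trans (chain_dvd (level_ge s)) xy.
  have uy := unit_congr R_val base_nonunit ux (dvd_subC gxy).
  apply: f_cong; apply/(level_subgroup_subE j_epi).
  by rewrite !normP // (eq_residue_rep gxy) -mulrBl; apply: dvd_mulr.
- move=> s t x st ux; have := f_lt s t (norm x) st; congr (_ < _); apply: f_cong.
  apply/(level_subgroup_subE j_epi).
  have gjx : dvd (r g) (j (c t s) * x - x).
    by rewrite -{2}[x]mul1r -mulrBl; apply: dvd_mulr; case: j_epi.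
  rewrite (principal_unit_epiD j_epi) !normP ?unitrM ?ju // (eq_residue_rep gjx).
  by rewrite mulrAC [x * _]mulrC subrr.
Qed.

End SpecializedCocycle.

(** * Direct limits of cyclic modules *)

Section SubQuotient.
Variables (R : idomainType) (V : lmodType R).

Definition submodule_pred (P : V -> Prop) of is_submodule P : {pred V} :=
  fun x => `[< P x >].

Variables (P : V -> Prop) (P_submodule : is_submodule P).
Local Notation S := (submodule_pred P_submodule).

Lemma submodule_pred_submod_closed : submod_closed S.
Proof.
case: P_submodule => [P0 PD PZ]; split; first exact/asboolP.
by move=> a x y /asboolP Px /asboolP Py; apply/asboolP/PD => //; apply: PZ.
Qed.

HB.instance Definition _ := GRing.isZmodClosed.Build V S
  (GRing.submod_closedB submodule_pred_submod_closed).

Definition submodule : Type := {x : V | x \in S}.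
HB.instance Definition _ := SubType.on submodule.
HB.instance Definition _ := Choice.on submodule.
HB.instance Definition _ := GRing.SubChoice_isSubLmodule.Build R V S submodule
  submodule_pred_submod_closed.

Definition quotient_module : Type := Quotient.quot S.
HB.instance Definition _ := GRing.Zmodule.on quotient_module.
HB.instance Definition _ := EqQuotient.on quotient_module.

Lemma quotient_pi_eq x y : \pi_quotient_module x = \pi_quotient_module y <-> P (x - y).
Proof.
have S_P : x - y \in S <-> P (x - y) := iff_sym (rwP (asboolP _)).
by apply: iff_trans S_P; rewrite Quotient.idealrBE; split=> [->|/eqP].
Qed.

Lemma quotient_piD : {morph \pi_quotient_module : x y / x + y}.
Proof. exact: (raddfD \pi_(Quotient.quot S)). Qed.

Definition quotient_scale (a : R) (u : quotient_module) : quotient_module :=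
  \pi_quotient_module (a *: repr u).

Lemma quotient_scale_pi a x :
  quotient_scale a (\pi_quotient_module x) = \pi_quotient_module (a *: x).
Proof.
apply/quotient_pi_eq; rewrite -scalerBr; have [_ _ PZ] := P_submodule; apply: PZ.
by apply/quotient_pi_eq; rewrite reprK.
Qed.

Lemma quotient_scaleA a b u :
  quotient_scale a (quotient_scale b u) = quotient_scale (a * b) u.
Proof. by rewrite -[u]reprK (quotient_scale_pi b) !quotient_scale_pi scalerA. Qed.

Lemma quotient_scale1 : left_id 1 quotient_scale.
Proof. by move=> u; rewrite -[u]reprK quotient_scale_pi scale1r. Qed.

Lemma quotient_scaleDr : right_distributive quotient_scale +%R.
Proof.
move=> a u w; rewrite -[u]reprK -[w]reprK -quotient_piD !quotient_scale_pi.
by rewrite -quotient_piD scalerDr.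
Qed.

Lemma quotient_scaleDl u : {morph quotient_scale^~ u : a b / a + b}.
Proof.
by move=> a b; rewrite -[u]reprK !quotient_scale_pi scalerDl quotient_piD.
Qed.

HB.instance Definition _ := GRing.Zmodule_isLmodule.Build R quotient_module
  quotient_scaleA quotient_scale1 quotient_scaleDr quotient_scaleDl.

Lemma quotient_piZ a x :
  \pi_quotient_module (a *: x) = a *: (\pi_quotient_module x : quotient_module).
Proof. exact/esym/quotient_scale_pi. Qed.

Lemma quotient_pi_eq0 x : \pi_quotient_module x = 0 :> quotient_module <-> P x.
Proof.
rewrite -{2}[x]subr0; apply: iff_trans (quotient_pi_eq x 0).
by rewrite [in X in _ <-> X](raddf0 \pi_(Quotient.quot S)).
Qed.

End SubQuotient.

Lemma mulf_divMr (F : fieldType) (x y z k : F) :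
  k != 0 -> x * k * (y / (z * k)) = y * x / z.
Proof.
move=> k_neq0; rewrite -[RHS]mulr1 -(divff k_neq0) mulf_div mulrA; congr (_ / _).
by rewrite mulrAC [y * x]mulrC.
Qed.

Section FractionModule.
Variable R : idomainType.
Implicit Types (a b k : R) (x y z : {fraction R}).

Lemma inRD x y : inR x -> inR y -> inR (x + y).
Proof. by move=> [a ->] [b ->]; exists (a + b); rewrite rmorphD. Qed.

Lemma inRM a x : inR x -> inR (a%:F * x).
Proof. by move=> [b ->]; exists (a * b); rewrite rmorphM. Qed.

Lemma inRN x : inR x -> inR (- x).
Proof. by move=> [b ->]; exists (- b); rewrite rmorphN. Qed.

Lemma inR_subC x y : inR (x - y) -> inR (y - x).
Proof. by rewrite -[y - x]opprB; apply: inRN. Qed.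

Lemma inR_sub_trans y x z : inR (x - y) -> inR (y - z) -> inR (x - z).
Proof. by move=> xy /(inRD xy); rewrite subrKA. Qed.

Lemma tofrac_inj : injective (@FracField.tofrac R).
Proof. by move=> a b /eqP; rewrite tofrac_eq => /eqP. Qed.

Definition integral_part (x : {fraction R}) : R := xget 0 [set u | x = u%:F].

Lemma tofracK : cancel (@FracField.tofrac R) integral_part.
Proof.
by move=> u; apply/tofrac_inj/esym/(@xgetPex R 0 [set t | u%:F = t%:F]); exists u.
Qed.

Lemma inR_div a b : b != 0 -> inR (a%:F / b%:F) <-> dvd b a.
Proof.
rewrite -tofrac_eq0 => b0; split=> [[t]|[t ->]].
  move/(congr1 ( *%R^~ b%:F)); rewrite divfK // -rmorphM => /tofrac_inj ->.
  by exists t; rewrite mulrC.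
by exists t; rewrite rmorphM /= mulrC mulKf.
Qed.

Definition frac_module : Type := {fraction R}.
HB.instance Definition _ := GRing.Zmodule.on frac_module.

Lemma frac_scaleA a b (x : frac_module) :
  a%:F * (b%:F * x) = (a * b)%:F * x :> {fraction R}.
Proof. by rewrite rmorphM mulrA. Qed.

Lemma frac_scale1 : left_id 1 (fun a (x : frac_module) => a%:F * x : frac_module).
Proof. by move=> x; rewrite rmorph1 mul1r. Qed.

Lemma frac_scaleDr :
  right_distributive (fun a (x : frac_module) => a%:F * x : frac_module) +%R.
Proof. by move=> a x y; apply: mulrDr. Qed.

Lemma frac_scaleDl (x : frac_module) :
  {morph (fun a => a%:F * x : frac_module) : a b / a + b}.
Proof. by move=> a b; rewrite rmorphD; apply: mulrDl. Qed.

HB.instance Definition _ := GRing.Zmodule_isLmodule.Build R frac_module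
  frac_scaleA frac_scale1 frac_scaleDr frac_scaleDl.

End FractionModule.

Definition is_tower (disp : Order.disp_t) (L : orderType disp) (R : idomainType)
    (p : L -> R) (c : L -> L -> R) (U : lmodType R) (b : L -> U) : Prop :=
  [/\ forall u, exists s a, u = a *: b s,
      forall s t k, (s < t)%O -> p t = p s * k -> b s = (c t s * k) *: b t
    & forall s, ann_eq (b s) (p s)].

(* The direct limit of the modules [R / p_s R] along the maps
   [1 |-> c_ts p_t / p_s], realized inside the germs at infinity of functions
   [L -> Q/R] by sending the generator of level [s] to [t |-> c_ts / p_s]. *)
Section TwistedLimit.
Context (disp : Order.disp_t) (L : orderType disp) (R : idomainType).
Variables (p : L -> R) (c : L -> L -> R) (s0 : L).
Hypothesis L_unbounded : forall s : L, exists t : L, (s < t)%O.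
Hypothesis p_neq0 : forall s, p s != 0.
Hypothesis p_dvd : forall s t, (s < t)%O -> dvd (p s) (p t).
Hypothesis c_cocycle : unit_cocycle p c.

Definition null_germ (h : L -> frac_module R) : Prop :=
  exists s, forall t, (s < t)%O -> @inR R (h t).

Lemma null_germ_submodule : is_submodule null_germ.
Proof.
split=> [|x y [s xs] [t yt]|a x [s xs]].
- by exists s0 => t _; exists 0; rewrite rmorph0.
- exists (Order.max s t) => u; rewrite gt_max => /andP[su tu].
  by apply: inRD; [apply: xs|apply: yt].
- by exists s => t /xs; apply: inRM.
Qed.

Local Notation germ := (quotient_module null_germ_submodule).

Definition germ_gen (s : L) : germ :=
  \pi_germ ((fun t => (c t s)%:F / (p s)%:F) : L -> frac_module R).

Lemma germ_gen_lift s t k : (s < t)%O -> p t = p s * k ->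
  germ_gen s = (c t s * k) *: germ_gen t.
Proof.
move=> st ptE; rewrite /germ_gen -quotient_piZ; apply/quotient_pi_eq.
exists t => u tu; have [_ c_coh] := c_cocycle.
have pF w : (p w)%:F != 0 by rewrite tofrac_eq0.
have k_neq0 : k%:F != 0.
  by have := pF t; rewrite ptE rmorphM mulf_eq0 negb_or => /andP[].
apply: inR_subC.
rewrite -[X in inR X]/((c t s * k)%:F * ((c u t)%:F / (p t)%:F)
  - (c u s)%:F / (p s)%:F).
rewrite ptE !rmorphM /= mulf_divMr // -mulrBl -rmorphM -rmorphB.
by apply/inR_div => //; apply: c_coh.
Qed.

Lemma germ_gen_ann s : ann_eq (germ_gen s) (p s).
Proof.
have [c_unit _] := c_cocycle.
move=> a; rewrite /germ_gen -quotient_piZ; apply: iff_trans (quotient_pi_eq0 _ _) _.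
have scaleE t : (a *: ((fun t => (c t s)%:F / (p s)%:F) : L -> frac_module R)) t =
    (a * c t s)%:F / (p s)%:F by rewrite rmorphM -mulrA.
split=> [[t tP]|pa].
  have [u tu] := L_unbounded t; have := tP _ tu.
  rewrite scaleE => /(inR_div _ (p_neq0 s)).
  by rewrite mulrC; apply: dvd_unit_mull.
by exists s => t _; rewrite scaleE; apply/inR_div => //; apply: dvd_mulr.
Qed.

Definition in_span (x : germ) : Prop := exists s a, x = a *: germ_gen s.

Lemma in_span_submodule : is_submodule in_span.
Proof.
split=> [|x y [s [a ->]] [t [a' ->]]|a x [s [a' ->]]].
- by exists s0, 0; rewrite scale0r.
- have [u] := L_unbounded (Order.max s t); rewrite gt_max => /andP[su tu].
  have [[k pk] [k' pk']] := (p_dvd su, p_dvd tu).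
  rewrite (germ_gen_lift su pk) (germ_gen_lift tu pk') !scalerA -scalerDl.
  by exists u, (a * (c u s * k) + a' * (c u t * k')).
- by exists s, (a * a'); rewrite scalerA.
Qed.

Theorem twisted_limit_exists : exists (U : lmodType R) (b : L -> U), is_tower p c b.
Proof.
have gen_span s : in_span (germ_gen s) by exists s, 1; rewrite scale1r.
pose U : lmodType R := submodule in_span_submodule.
pose b s : U := exist _ (germ_gen s) (introT (asboolP _) (gen_span s)).
exists U, b; split.
- move=> u; have /asboolP[s [a uE]] := valP u; exists s, a; apply: val_inj.
  by rewrite GRing.valZ.
- by move=> s t k st pk; apply: val_inj; rewrite GRing.valZ; apply: germ_gen_lift.
- move=> s a; apply: iff_trans (germ_gen_ann s a).
  by split=> [/(congr1 val)|E]; [|apply: val_inj]; rewrite GRing.valZ ?GRing.val0.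
Qed.

End TwistedLimit.

(** * Uniserial modules and their isomorphisms to cyclic quotients *)

Section CyclicSubmodules.
Variables (R : idomainType) (U : lmodType R).
Implicit Types (x y a : U) (p q k : R).

Lemma in_cyc_refl a : in_cyc a a.
Proof. by exists 1; rewrite scale1r. Qed.

Lemma in_cycZ a k x : in_cyc a x -> in_cyc a (k *: x).
Proof. by move=> [t ->]; exists (k * t); rewrite scalerA. Qed.

Lemma in_cyc_trans a x y : in_cyc a x -> in_cyc x y -> in_cyc a y.
Proof. by move=> ax [t ->]; apply: in_cycZ. Qed.

Lemma uniserial_cyc_total x y : uniserial U -> in_cyc y x \/ in_cyc x y.
Proof.
have cyc a : is_submodule (in_cyc a).
  split=> [|_ _ [s ->] [t ->]|s z]; last exact: in_cycZ.
    by exists 0; rewrite scale0r.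
  by exists (s + t); rewrite scalerDl.
move=> /(_ _ _ (cyc x) (cyc y))[] sub; [left|right]; exact/sub/in_cyc_refl.
Qed.

Lemma ann_eq_in_cyc x y p q : valuation_domain R -> uniserial U ->
  ann_eq x p -> ann_eq y q -> p != 0 -> dvd p q -> in_cyc y x.
Proof.
move=> R_val U_uni xp yq p_neq0 pq; case: (uniserial_cyc_total x y U_uni) => // -[k yE].
have [p1|p_nonunit] := pselect (dvd p 1).
  by exists 0; rewrite scale0r -[x]scale1r; apply/xp.
have k_unit : k \is a GRing.unit.
  apply: (unit_of_dvd_cancel R_val p_neq0 p_nonunit) => m pkm.
  by apply: dvd_trans pq _; apply/yq; rewrite yE scalerA mulrC; apply/xp.
by exists k^-1; rewrite yE scalerA mulVr // scale1r.
Qed.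

Lemma iso_repZ a q psi k x : iso_rep a q psi -> in_cyc a x ->
  inR (psi (k *: x) - k%:F * psi x).
Proof.
move=> [_ psi_lin _ _] ax; have := psi_lin x x k 0 ax ax.
by rewrite scale0r addr0 rmorph0 mul0r addr0.
Qed.

Lemma iso_rep_ann a q psi p x : iso_rep a q psi -> in_cyc a x -> ann_eq x p ->
  forall k, inR (k%:F * psi x) <-> dvd p k.
Proof.
move=> psi_iso ax xp k; have psiZ := iso_repZ k psi_iso ax.
have [_ _ psi_ker _] := psi_iso.
apply: iff_trans (xp k); apply: iff_trans (psi_ker _ (in_cycZ k ax)).
split=> inRk; first by rewrite -[psi _](subrK (k%:F * psi x)); apply: inRD.
by rewrite -[_ * _](subrK (psi (k *: x))); apply: inRD inRk; apply: inR_subC.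
Qed.

Lemma iso_rep_unit a q psi p x : valuation_domain R ->
  iso_rep a q psi -> in_cyc a x -> ann_eq x p -> p != 0 -> ~ dvd p 1 ->
  exists2 u, u \is a GRing.unit & psi x = u%:F / p%:F.
Proof.
move=> R_val psi_iso ax xp p_neq0 p_nonunit; have psi_ann := iso_rep_ann psi_iso ax xp.
have pF : p%:F != 0 by rewrite tofrac_eq0.
have [u uE] : inR (p%:F * psi x) by apply/psi_ann.
have psiE : psi x = u%:F / p%:F by rewrite -uE mulrAC divff // mul1r.
have dvd_mulu k : dvd p (k * u) <-> dvd p k.
  apply: iff_trans (psi_ann k); rewrite psiE mulrA -rmorphM.
  exact: iff_sym (inR_div _ p_neq0).
exists u => //; apply: (unit_of_dvd_cancel R_val p_neq0 p_nonunit) => m.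
by rewrite mulrC => /dvd_mulu.
Qed.

End CyclicSubmodules.

Lemma in_invR_dvd (R : idomainType) (p q : R) (x : {fraction R}) :
  dvd p q -> in_invR p x -> in_invR q x.
Proof.
by move=> [k ->] /(inRM k); rewrite /in_invR rmorphM mulrCA [k%:F * _]mulrC.
Qed.

Section Tower.
Context (disp : Order.disp_t) (L : orderType disp) (R : idomainType).
Variables (p : L -> R) (c : L -> L -> R) (U : lmodType R) (b : L -> U).
Hypothesis R_val : valuation_domain R.
Hypothesis L_unbounded : forall s : L, exists t : L, (s < t)%O.
Hypothesis p_neq0 : forall s, p s != 0.
Hypothesis p_dvd : forall s t, (s < t)%O -> dvd (p s) (p t).
Hypothesis p_nonunit : forall s, ~ dvd (p s) 1.
Hypothesis c_unit : forall s t, c s t \is a GRing.unit.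
Hypothesis b_tower : is_tower p c b.

Lemma tower_gen_above u s : exists (t : L) a, (s < t)%O /\ u = a *: b t.
Proof.
have [b_gen b_lift _] := b_tower; have [l [a ->]] := b_gen u.
have [t] := L_unbounded (Order.max s l); rewrite gt_max => /andP[st l_below].
have [k pk] := p_dvd l_below.
by exists t, (a * (c t l * k)); rewrite -scalerA -b_lift.
Qed.

Lemma tower_uniserial : uniserial U.
Proof.
have [b_gen b_lift _] := b_tower; move=> A B [_ _ AZ] [_ _ BZ].
have [AB|/existsNP[x /not_implyP[Ax nBx]]] := pselect (forall x, A x -> B x).
  by left.
right=> y By; have [l [a xE]] := b_gen x.
have [t [a' [l_below yE]]] := tower_gen_above y l; have [k pk] := p_dvd l_below.
have {}xE : x = (a * (c t l * k)) *: b t.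
  by rewrite xE (b_lift _ _ _ l_below pk) scalerA.
case: (dvd_total R_val (a * (c t l * k)) a') => -[m mE].
  by rewrite yE mE mulrC -scalerA -xE; apply: AZ.
by case: nBx; rewrite xE mE mulrC -scalerA -yE; apply: BZ.
Qed.

Lemma tower_gen_neq0 s : b s != 0.
Proof.
have [_ _ b_ann] := b_tower.
by apply/eqP => bs0; apply: (p_nonunit (s := s)); apply/b_ann; rewrite bs0 scaler0.
Qed.

(* If [q u = b s] and [u = a b_t], then [q a] and [c_ts p_t / p_s] agree modulo
   [p_t], so [q] divides [p_t / p_s]. *)
Lemma tower_quotient_dvd s t q a k : p t = p s * k -> (s < t)%O ->
  b s = q *: (a *: b t) -> dvd q k.
Proof.
have [_ b_lift b_ann] := b_tower; move=> ptE st bsE.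
have [m mE] : dvd (p t) (q * a - c t s * k).
  by apply/b_ann; rewrite scalerBl -scalerA -bsE -b_lift // subrr.
pose e := c t s + p s * m.
have e_unit : e \is a GRing.unit.
  apply: (unit_congr R_val (@p_nonunit s) (c_unit t s)).
  by rewrite /e addrC addKr; exists m.
exists (a / e); apply: (mulIr e_unit); rewrite mulrA divrK //.
by rewrite -[q * a](subrK (c t s * k)) mE ptE /e; ring.
Qed.

Lemma tower_divisor s t k : p t = p s * k -> (s < t)%O ->
  k != 0 /\ exists u, b s = k *: u.
Proof.
have [_ b_lift _] := b_tower; move=> ptE st; split.
  by apply: contraNneq (p_neq0 t) => k_eq0; rewrite ptE k_eq0 mulr0.
by exists (c t s *: b t); rewrite scalerA mulrC; apply: b_lift.
Qed.

Lemma tower_has_type (J : {fraction R} -> Prop) (s : L) :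
  (forall x, J x <-> exists t, in_invR (p t) x) -> has_type U J.
Proof.
have [_ _ b_ann] := b_tower.
move=> JP; exists (b s); split; first exact: tower_gen_neq0.
have psF : (p s)%:F != 0 by rewrite tofrac_eq0.
exists (fun x => (p s)%:F * x); split.
- move=> x /JP[t [z xzE]]; have [u] := L_unbounded (Order.max s t).
  rewrite gt_max => /andP[su tu]; have [[k kE] [m mE]] := (p_dvd su, p_dvd tu).
  have [k_neq0 bs_k] := tower_divisor kE su; exists k; split=> //.
  exists (z * m); rewrite mulrC mulrA -rmorphM mulrC [k * _]mulrC -kE mE rmorphM.
  by rewrite mulrA xzE -rmorphM.
- move=> x y k m _ _; exists 0; rewrite ?scale0r // rmorph0.
  by apply/eqP; rewrite subr_eq0 mulrDr !(mulrCA (p s)%:F).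
- move=> x _; split=> [[k /b_ann[t ->]]|[t ->]].
    by rewrite rmorphM /= => /(mulfI psF) ->; exists t.
  by exists (p s * t); [apply/b_ann; exists t|rewrite rmorphM].
- move=> y [q [q_neq0 [u bsE] [z yzE]]]; exists ((p s)%:F^-1 * y); last first.
    by exists 0; rewrite ?scale0r // mulVKf // subrr rmorph0.
  have [t [a [st uE]]] := tower_gen_above u s; have [k kE] := p_dvd st.
  have [n nE] : dvd q k by apply: (tower_quotient_dvd (a := a) kE st); rewrite -uE.
  apply/JP; exists t, (z * n); rewrite kE nE !rmorphM /= -yzE.
  by rewrite mulrA [_^-1 * y]mulrC mulfVK // mulrA.
Qed.

Lemma tower_ann_exists (q : R) (s : L) : q != 0 -> dvd q (p s) ->
  exists x : U, ann_eq x q.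
Proof.
have [_ _ b_ann] := b_tower; move=> q_neq0 [k kE]; exists (k *: b s) => x.
rewrite scalerA.
have k_neq0 : k != 0 by apply: contraNneq (p_neq0 s) => k_eq0; rewrite kE k_eq0 mulr0.
apply: iff_trans (b_ann s _) _; rewrite kE; split=> [[y]|[y ->]].
  by rewrite -mulrA [k * y]mulrC mulrA => /(mulIf k_neq0) ->; exists y.
by exists y; rewrite mulrAC.
Qed.

End Tower.

Section SpecialFamily.
Context (disp : Order.disp_t) (W : orderType disp) (R : idomainType).
Variables (r : W -> R) (g : W) (U : lmodType R).
Hypothesis R_val : valuation_domain R.
Hypothesis W_omega1 : omega1_order (fun x y : W => x < y)%O.
Hypothesis r_neq0 : forall s, r s != 0.
Hypothesis r_le : forall s t, (s <= t)%O -> dvd (r s) (r t).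
Hypothesis U_uniserial : uniserial U.

Local Notation p := (fun l : level g => r (val l)).

Variables (c : level g -> level g -> R) (b : level g -> U) (f : level g -> R -> rat).
Hypothesis level_nonunit : forall l : level g, ~ dvd (r (val l)) 1.
Hypothesis b_tower : is_tower p c b.
Hypothesis f_specializes : specializes p c f.

Variable a : W -> U.
Hypothesis a_ann : forall s, ann_eq (a s) (r s).

(* A node is an isomorphism [a_s R -> r_s^-1 R / R], given by its level and a
   representative. *)
Implicit Types (x y z : W * (U -> {fraction R})) (l m : level g).

Definition is_node x : Prop := iso_rep (a x.1) (r x.1) x.2.

Definition node_le x y : Prop :=
  [/\ is_node x, is_node y, (x.1 <= y.1)%O & extends_on (a x.1) y.2 x.2].

Lemma in_cyc_le s t : (s <= t)%O -> in_cyc (a t) (a s).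
Proof.
move=> /r_le.
exact: (ann_eq_in_cyc R_val U_uniserial (a_ann s) (a_ann t) (r_neq0 s)).
Qed.

Lemma gen_in_cyc l s : (val l <= s)%O -> in_cyc (a s) (b l).
Proof.
move=> /r_le; have [_ _ b_ann] := b_tower.
exact: (ann_eq_in_cyc R_val U_uniserial (b_ann l) (a_ann s) (r_neq0 _)).
Qed.

Lemma node_le_refl x : is_node x -> node_le x x.
Proof. by move=> xn; split=> // u _; exists 0; rewrite subrr rmorph0. Qed.

Lemma node_le_trans x y z : node_le x y -> node_le y z -> node_le x z.
Proof.
move=> [xn _ xy yx_ext] [_ zn yz zy_ext]; split=> //; first exact: le_trans yz.
move=> u u_in; apply: inR_sub_trans (yx_ext u u_in).
exact/zy_ext/in_cyc_trans/u_in/in_cyc_le.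
Qed.

Definition coefficient x l : R := integral_part (x.2 (b l) * (r (val l))%:F).

Lemma coefficientP x l : is_node x -> (val l <= x.1)%O ->
  coefficient x l \is a GRing.unit /\ x.2 (b l) = (coefficient x l)%:F / (r (val l))%:F.
Proof.
have [_ _ b_ann] := b_tower; move=> xn lx.
have [u uu xbE] :=
  iso_rep_unit R_val xn (gen_in_cyc lx) (b_ann l) (r_neq0 _) (@level_nonunit l).
by rewrite /coefficient xbE divfK ?tofrac_eq0 // tofracK.
Qed.

Lemma value_eq x y l : node_le x y -> (val l <= x.1)%O ->
  f l (coefficient x l) = f l (coefficient y l).
Proof.
move=> [xn yn xy yx_ext] lx; have [f_cong _] := f_specializes.
have [xu xE] := coefficientP xn lx; have [_ yE] := coefficientP yn (le_trans lx xy).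
apply: f_cong => //; apply/(inR_div _ (r_neq0 (val l))).
by rewrite rmorphB mulrBl -xE -yE; apply/inR_subC/yx_ext/gen_in_cyc.
Qed.

Lemma value_lt y l m : is_node y -> (l < m)%O -> (val m <= y.1)%O ->
  f l (coefficient y l) < f m (coefficient y m).
Proof.
move=> yn lm my; have [f_cong f_lt] := f_specializes.
have [_ b_lift _] := b_tower; have vlm : (val l <= val m)%O := ltW lm.
have ly := le_trans vlm my.
have [lu lE] := coefficientP yn ly; have [mu mE] := coefficientP yn my.
rewrite (f_cong _ _ (c m l * coefficient y m)) //; first exact: f_lt.
have [k kE] := r_le vlm.
have k_neq0 : k%:F != 0.
  rewrite tofrac_eq0; apply: contraNneq (r_neq0 (val m)) => k_eq0.
  by rewrite kE k_eq0 mulr0.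
apply/(inR_div _ (r_neq0 (val l))).
have := iso_repZ (c m l * k) yn (gen_in_cyc my); rewrite -b_lift // lE mE kE.
by rewrite !(rmorphM, rmorphB) /= mulf_divMr // [_ * (c m l)%:F]mulrC mulrBl.
Qed.

Lemma node_colouring_exists : exists col : W * (U -> {fraction R}) -> nat,
  (forall x y, node_le x y -> x.1 = y.1 -> col x = col y) /\
  forall x y, node_le x y -> (x.1 < y.1)%O -> col x <> col y.
Proof.
have [last [idx [last_le last_lt]]] := last_levels_exist W_omega1 g.
have /countable_setP/countable_injP[low low_inj] := omega1_countable W_omega1 g.
pose colour x : nat + rat * nat := if (x.1 < g)%O then inl (low x.1)
  else inr (f (last x.1) (coefficient x (last x.1)), idx x.1).
exists (pickle \o colour); split=> x y xy.
  move=> xyE; congr pickle; rewrite /colour xyE; case: ltP => // gy.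
  by rewrite (value_eq xy) // xyE; apply: last_le.
have [_ yn _ _] := xy => x_lt /(pcan_inj pickleK); rewrite /colour.
case: ltP => [xg|gx]; case: ltP => [yg|gy] //.
  by move=> -[/low_inj]; rewrite !inE => /(_ xg yg) E; rewrite E ltxx in x_lt.
case: (last_lt _ _ gx x_lt) => [lm|[_ idx_neq]] -[f_eq idx_eq //].
move: f_eq; rewrite (value_eq xy (last_le _ gx)) => f_eq.
by have := value_lt yn lm (last_le _ gy); rewrite f_eq ltxx.
Qed.

Theorem special_family_exists : exists h, special_family (fun x y : W => x < y)%O r a h.
Proof.
have [col [col_eq col_neq]] := node_colouring_exists.
have [|h [h_eq h_lt]] := specialization_of_colouring node_le_trans (col := col).
  move=> x y xy yx; apply: col_eq => //; apply/eqP; rewrite eq_le.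
  by case: xy yx => [_ _ -> _] [_ _ -> _].
exists (fun s psi => h (s, psi)); split.
  move=> s psi psi' psi_iso psi'_iso ext.
  by apply: h_eq; split=> //= u /ext; apply: inR_subC.
move=> s t psi phi st psi_iso phi_iso ext.
have xy : node_le (s, psi) (t, phi) by split=> //; apply: ltW.
apply: h_lt => //; first exact: node_le_refl.
move=> z zx; apply: col_neq (node_le_trans zx xy) _.
by case: zx => _ _ zs _; apply: le_lt_trans st.
Qed.

End SpecialFamily.

Lemma omega1_order_ind (P : forall W : Type, (W -> W -> Prop) -> Prop) :
  (forall (disp : Order.disp_t) (W : orderType disp),
     omega1_order (fun x y : W => x < y)%O -> P W (fun x y => x < y)%O) ->
  forall W lt, @omega1_order W lt -> P W lt.
Proof.
move=> P_order W lt W_omega1; have [lt_irr [lt_trans [lt_total _]]] := W_omega1.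
pose ltb x y := `[< lt x y >].
have ltb_irr : irreflexive ltb by move=> x; apply/asboolPn/lt_irr.
have ltb_trans : transitive ltb.
  by move=> y x z /asboolP xy /asboolP yz; apply/asboolP/lt_trans/yz.
pose C : choiceType := HB.pack W (gen_eqMixin W) (gen_choiceMixin W).
have ltb_total (x y : C) : x != y -> ltb x y || ltb y x.
  move=> /eqP xy; rewrite -asbool_or; apply/asboolP.
  by case: (lt_total x y) => [|[]]; auto.
pose disp := Order.Disp tt tt.
pose T : orderType disp := HB.pack W C (Order.LtOrder.Build disp C (fun _ _ => erefl)
  (fun _ _ => erefl) (fun _ _ => erefl) ltb_irr ltb_trans ltb_total).
have ltE : lt = fun x y : T => (x < y)%O.
  by apply/funext => x; apply/funext => y; apply/esym/asboolE.
by move: W_omega1; rewrite ltE; apply: (P_order disp T).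
Qed.

Theorem mainTheorem7 (R : idomainType) (HR : valuation_domain R)
    (Hcard : card_aleph1 R)
    (J : {fraction R} -> Prop) (W : Type) (lt : W -> W -> Prop)
    (HW : omega1_order lt) (r : W -> R)
    (HJ : type_presentation J lt r) (Hess : ess_countable lt r)
    (HnJ : ~ countably_generated J) :
  exists U : lmodType R,
    [/\ uniserial U, has_type U J & explicitly_nonstandard U lt r].
Proof.
elim/omega1_order_ind: {W lt} HW r HJ Hess => disp W HW r.
move=> [_ _ r_neq0 r_chain JP] [g0 r_countable].
have [g /(_ 0%N) g0g] := omega1_bounded HW (fun=> g0).
have cofinal := level_cofinal HW g; have [l0 _] := cofinal g.
have unbounded := level_unbounded HW (g := g).
have p_dvd (s t : level g) (st : (s < t)%O) := (r_chain _ _ st).1.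
have p_neq0 (s : level g) := r_neq0 (val s).
have p_nonunit := level_nonunit r_chain g0g.
have [c [f [c_cocycle f_specializes]]] :=
  specialized_cocycle_exists HR HW r_chain g0g r_countable.
have [U [b b_tower]] := twisted_limit_exists l0 unbounded p_neq0 p_dvd c_cocycle.
have U_uniserial := tower_uniserial HR unbounded p_dvd b_tower.
exists U; split=> //; last split.
- have [c_unit _] := c_cocycle.
  apply: (tower_has_type HR unbounded p_neq0 p_dvd p_nonunit c_unit b_tower l0) => x.
  apply: iff_trans (JP x) _; split=> [[s xs]|[l xl]]; last by exists (val l).
  have [l sl] := cofinal s; exists l; exact: in_invR_dvd (r_chain _ _ sl).1 xs.
- suff /choice[a a_ann] : forall s, exists x : U, ann_eq x (r s) by exists a.
  move=> s; have [l sl] := cofinal s.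
  exact: (tower_ann_exists p_neq0 b_tower (r_neq0 s) (r_chain _ _ sl).1).
- move=> a; exact: (special_family_exists HR HW r_neq0 (chain_dvd r_chain)
    U_uniserial p_nonunit b_tower f_specializes).
Qed.
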